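(* For a ring $R$ the following are equivalent: (1) $R$ is left Noetherian. (2) For every monomorphism $f: A\to E$ of left $R$-modules, $f$ is an injective preenvelope of $A$ if and only if $f^+: E^+\to A^+$ is a flat precover of $A^+$ in $\mathrm{Mod}\,R^{op}$. Moreover, if these conditions hold and $f: A\to E$ is a monomorphism of left $R$-modules such that $f^+: E^+\to A^+$ is a flat cover of $A^+$, then $f$ is an injective envelope of $A$.
   Context: $(-)^+=\mathrm{Hom}_{\mathbb{Z}}(-,\mathbb{Q}/\mathbb{Z})$. An injective preenvelope of $A$ is a homomorphism $A\to E$ with $E$ injective through which every homomorphism from $A$ to an injective module factors; it is an injective envelope if moreover it is left minimal (every endomorphism $h$ of $E$ with $hf=f$ is an automorphism). A flat precover of $M$ is a homomorphism $F\to M$ with $F$ flat through which every homomorphism from a flat module to $M$ factors; it is a flat cover if moreover it is right minimal (every endomorphism $h$ of $F$ with $fh=f$ is an automorphism). *)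

(* Defs.v *)
From Stdlib Require Import ClassicalEpsilon FunctionalExtensionality ProofIrrelevance.
From HB Require Import structures.
From mathcomp Require Import all_boot all_order all_algebra.
Set Implicit Arguments. Unset Strict Implicit. Unset Printing Implicit Defensive.
Import Order.TTheory GRing.Theory Num.Theory.
Local Open Scope ring_scope.

(* Classical decidable equality / choice on an arbitrary type (used to    *)
(* give the character modules E^+ their eqType/choiceType structures).    *)

Definition cdec (P : Prop) : {P} + {~ P}.
Proof.
have ex : exists b : bool, if b then P else ~ P.
  by case: (classic P) => H; [exists true | exists false].
case: (constructive_indefinite_description _ ex) => [[]] H; by [left | right].
Defined.

Definition ceq (T : Type) (x y : T) : bool := if cdec (x = y) then true else false.

Lemma ceqP (T : Type) : Equality.axiom (@ceq T).
Proof. by move=> x y; rewrite /ceq; case: cdec => H; constructor. Qed.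

Definition cfind (T : Type) (P : pred T) (n : nat) : option T :=
  match cdec (exists x, P x) with
  | left H => Some (proj1_sig (constructive_indefinite_description _ H))
  | right _ => None
  end.

Lemma cfind_correct (T : Type) (P : pred T) n x : cfind P n = Some x -> P x.
Proof.
rewrite /cfind; case: cdec => // H [<-].
by case: (constructive_indefinite_description _ H).
Qed.

Lemma cfind_complete (T : Type) (P : pred T) :
  (exists x, P x) -> exists n, cfind P n.
Proof. by move=> H; exists 0%N; rewrite /cfind; case: cdec. Qed.

Lemma cfind_ext (T : Type) (P Q : pred T) : P =1 Q -> cfind P =1 cfind Q.
Proof. by move=> /functional_extensionality ->. Qed.

(* The abelian group Q/Z, realised as the rationals in [0,1) with         *)
(* addition modulo 1.                                                     *)

Definition fr (x : rat) : rat := x - (Num.floor x)%:~R.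

Lemma fr_addz (x : rat) (z : int) : fr (x + z%:~R) = fr x.
Proof.
rewrite /fr floorDrz ?intr_int // intrKfloor rmorphD /=.
by rewrite opprD addrACA subrr addr0.
Qed.

Lemma fr_frl (x y : rat) : fr (fr x + y) = fr (x + y).
Proof.
have -> : fr x + y = (x + y) + (- Num.floor x)%:~R.
  by rewrite /fr rmorphN /= addrAC.
exact: fr_addz.
Qed.

Lemma fr_frr (x y : rat) : fr (x + fr y) = fr (x + y).
Proof. by rewrite addrC fr_frl addrC. Qed.

Lemma fr_fr (x : rat) : fr (fr x) = fr x.
Proof. by have := fr_frl x 0; rewrite !addr0. Qed.

Definition QZ := {x : rat | fr x == x}.

Definition qz (x : rat) : QZ := exist _ (fr x) (introT eqP (fr_fr x)).

Lemma qzK (a : QZ) : qz (proj1_sig a) = a.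
Proof.
case: a => x Hx; rewrite /qz; apply: eq_sig_hprop => /=.
  by move=> ? p q; apply: eq_irrelevance.
exact/eqP.
Qed.

HB.instance Definition _ := [isSub for (@proj1_sig rat (fun x => fr x == x))].
HB.instance Definition _ := [Choice of QZ by <:].

Definition qz_zero : QZ := qz 0.
Definition qz_add (a b : QZ) : QZ := qz (proj1_sig a + proj1_sig b).
Definition qz_opp (a : QZ) : QZ := qz (- proj1_sig a).

Lemma qz_eq (x y : rat) : fr x = fr y -> qz x = qz y.
Proof. by move=> e; apply: val_inj; rewrite /= e. Qed.

Lemma qz_addA : associative qz_add.
Proof. by move=> a b c; apply: qz_eq => /=; rewrite fr_frl fr_frr addrA. Qed.

Lemma qz_addC : commutative qz_add.
Proof. by move=> a b; rewrite /qz_add addrC. Qed.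

Lemma qz_add0 : left_id qz_zero qz_add.
Proof.
move=> a; rewrite /qz_add /qz_zero -[RHS]qzK; apply: qz_eq => /=.
by rewrite fr_frl add0r.
Qed.

Lemma qz_addN : left_inverse qz_zero qz_opp qz_add.
Proof. by move=> a; apply: qz_eq => /=; rewrite fr_frl addNr. Qed.

HB.instance Definition _ := GRing.isZmodule.Build QZ qz_addA qz_addC qz_add0 qz_addN.

(* Right R-modules are left R^c-modules (R^c = opposite ring R^op).       *)
(* The character module E^+ = Hom_Z(E, Q/Z) of a left R-module E, as a    *)
(* right R-module, with (phi . r)(x) = phi (r x).                         *)

Definition zadditive (E : zmodType) (f : E -> QZ) : Prop :=
  forall x y, f (x + y) = f x + f y.

Section CharacterModule.
Variables (R : pzRingType) (E : lmodType R).

Definition charmod := {f : E -> QZ | zadditive f}.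

Definition charfun (phi : charmod) : E -> QZ := proj1_sig phi.

HB.instance Definition _ := hasDecEq.Build charmod (@ceqP charmod).
HB.instance Definition _ :=
  hasChoice.Build charmod (@cfind_correct charmod) (@cfind_complete charmod)
    (@cfind_ext charmod).

Lemma charmod_ext (phi psi : charmod) : charfun phi =1 charfun psi -> phi = psi.
Proof.
case: phi psi => [f Hf] [g Hg] /= /functional_extensionality e.
by subst g; rewrite (proof_irrelevance _ Hf Hg).
Qed.

Lemma zadd_zero : zadditive (fun _ : E => (0 : QZ)).
Proof. by move=> x y; rewrite addr0. Qed.

Lemma zadd_add (phi psi : charmod) :
  zadditive (fun x => charfun phi x + charfun psi x).
Proof.
case: phi psi => [f Hf] [g Hg] x y /=.
by rewrite Hf Hg addrACA.
Qed.

Lemma zadd_opp (phi : charmod) : zadditive (fun x => - charfun phi x).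
Proof. by case: phi => [f Hf] x y /=; rewrite Hf opprD. Qed.

Definition char_zero : charmod := exist _ _ zadd_zero.
Definition char_add (phi psi : charmod) : charmod := exist _ _ (zadd_add phi psi).
Definition char_opp (phi : charmod) : charmod := exist _ _ (zadd_opp phi).

Lemma char_addA : associative char_add.
Proof. by move=> a b c; apply: charmod_ext => x /=; rewrite addrA. Qed.
Lemma char_addC : commutative char_add.
Proof. by move=> a b; apply: charmod_ext => x /=; rewrite addrC. Qed.
Lemma char_add0 : left_id char_zero char_add.
Proof. by move=> a; apply: charmod_ext => x /=; rewrite add0r. Qed.
Lemma char_addN : left_inverse char_zero char_opp char_add.
Proof. by move=> a; apply: charmod_ext => x /=; rewrite addNr. Qed.

HB.instance Definition _ :=
  GRing.isZmodule.Build charmod char_addA char_addC char_add0 char_addN.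

Lemma zadd_scale (r : R^c) (phi : charmod) :
  zadditive (fun x => charfun phi ((r : R) *: x)).
Proof. by case: phi => [f Hf] x y /=; rewrite scalerDr Hf. Qed.

Definition char_scale (r : R^c) (phi : charmod) : charmod :=
  exist _ _ (zadd_scale r phi).

Lemma char_scalerA a b v :
  char_scale a (char_scale b v) = char_scale (a * b) v.
Proof. by apply: charmod_ext => x /=; rewrite scalerA. Qed.
Lemma char_scale1r : left_id 1 char_scale.
Proof. by move=> v; apply: charmod_ext => x /=; rewrite scale1r. Qed.
Lemma char_scalerDr : right_distributive char_scale +%R.
Proof. by move=> a u v; apply: charmod_ext => x /=. Qed.
Lemma char_scalerDl v : {morph char_scale^~ v : a b / a + b}.
Proof.
move=> a b; apply: charmod_ext => x /=.
by rewrite scalerDl; case: v => f Hf /=; rewrite Hf.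
Qed.

HB.instance Definition _ :=
  GRing.Zmodule_isLmodule.Build R^c charmod
    char_scalerA char_scale1r char_scalerDr char_scalerDl.

End CharacterModule.


Section DualMap.
Variables (R : pzRingType) (A E : lmodType R) (f : {linear A -> E}).

Lemma zadd_comp (phi : charmod E) : zadditive (fun a => charfun phi (f a)).
Proof. by case: phi => [g Hg] x y /=; rewrite raddfD Hg. Qed.

Definition dualmap (phi : charmod E) : charmod A := exist _ _ (zadd_comp phi).
End DualMap.

(* Tensor products M (x)_R A (M a right, A a left R-module), described by *)
(* their elements: a finite formal sum  sum_i m_i (x) a_i  is given by a  *)
(* list of pairs, and  tequiv  is the congruence (on the free commutative *)
(* monoid of such lists) generated by the defining relations of the       *)
(* tensor product; the quotient is exactly M (x)_R A.                     *)

Section Tensor.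
Variables (R : pzRingType) (M : lmodType R^c) (A : lmodType R).

Inductive tequiv : seq (M * A) -> seq (M * A) -> Prop :=
| te_refl s : tequiv s s
| te_sym s t : tequiv s t -> tequiv t s
| te_trans s t u : tequiv s t -> tequiv t u -> tequiv s u
| te_perm s t : perm_eq s t -> tequiv s t
| te_cat s1 s2 t1 t2 : tequiv s1 t1 -> tequiv s2 t2 -> tequiv (s1 ++ s2) (t1 ++ t2)
| te_addl (m m' : M) (a : A) : tequiv [:: (m + m', a)] [:: (m, a); (m', a)]
| te_addr (m : M) (a a' : A) : tequiv [:: (m, a + a')] [:: (m, a); (m, a')]
| te_bal (r : R) (m : M) (a : A) :
    tequiv [:: ((r : R^c) *: m, a)] [:: (m, r *: a)]
| te_zero (a : A) : tequiv [:: (0, a)] [::].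

Definition tensor_zero (s : seq (M * A)) : Prop := tequiv s [::].
End Tensor.

Definition flat_mod (R : pzRingType) (M : lmodType R^c) : Prop :=
  forall (A B : lmodType R) (g : {linear A -> B}), injective g ->
  forall s : seq (M * A),
    tensor_zero (map (fun p => (p.1, g p.2)) s) -> tensor_zero s.

Definition injective_mod (R : pzRingType) (E : lmodType R) : Prop :=
  forall (A B : lmodType R) (i : {linear A -> B}), injective i ->
  forall g : {linear A -> E}, exists h : {linear B -> E}, forall a, h (i a) = g a.

Definition inj_preenvelope (R : pzRingType) (A E : lmodType R)
    (f : {linear A -> E}) : Prop :=
  injective_mod E /\
  forall (E' : lmodType R) (g : {linear A -> E'}), injective_mod E' ->
    exists h : {linear E -> E'}, forall a, h (f a) = g a.

Definition inj_envelope (R : pzRingType) (A E : lmodType R)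
    (f : {linear A -> E}) : Prop :=
  inj_preenvelope f /\
  forall h : {linear E -> E}, (forall a, h (f a) = f a) -> bijective h.

(* f : F -> M is a flat precover of M (right R-modules); f is a           *)
(* homomorphism in our uses.                                              *)
Definition flat_precover (R : pzRingType) (F M : lmodType R^c) (f : F -> M) : Prop :=
  flat_mod F /\
  forall (G : lmodType R^c) (g : {linear G -> M}), flat_mod G ->
    exists h : {linear G -> F}, forall x, f (h x) = g x.

Definition flat_cover (R : pzRingType) (F M : lmodType R^c) (f : F -> M) : Prop :=
  flat_precover f /\
  forall h : {linear F -> F}, (forall x, f (h x) = f x) -> bijective h.

Definition left_ideal (R : pzRingType) (I : R -> Prop) : Prop :=
  [/\ I 0, (forall x y, I x -> I y -> I (x + y)) & (forall r x, I x -> I (r * x))].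

Definition left_noetherian (R : pzRingType) : Prop :=
  forall I : nat -> R -> Prop,
    (forall n, left_ideal (I n)) ->
    (forall n x, I n x -> I n.+1 x) ->
    exists N, forall n, (N <= n)%N -> forall x, I n x -> I N x.

(* Main.v *)
Require Import Defs.
From Stdlib Require Import ClassicalEpsilon FunctionalExtensionality ProofIrrelevance.
From HB Require Import structures.
From mathcomp Require Import all_boot all_order all_algebra.
From mathcomp Require Import generic_quotient boolp classical_sets functions.
Set Implicit Arguments. Unset Strict Implicit. Unset Printing Implicit Defensive.
Import Order.TTheory GRing.Theory Num.Theory.
Local Open Scope ring_scope.

(** Baer's criterion, applied to the divisible group [Q/Z] over [int], makes
    characters extend and separate points. Hence a character of [M (x) A],
    that is a balanced map [M * A -> Q/Z], extends along a mono [A -> B] as soon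
    as [M (x) A -> M (x) B] is injective, which is why [f^+] is a flat precover
    once [E^+] is flat.

    Over a left Noetherian ring [E] is injective iff [E^+] is flat. If [E] is
    injective and [sum_i phi_i (x) a_i] dies in [E^+ (x) B], then [(phi_i)] kills
    every tuple of [E^n] satisfying the finitely generated relations [r_j] among
    the [a_i], so [phi_i = sum_j psi_j r_ji] and [sum_i phi_i (x) a_i = 0].
    If [E^+] is flat and a map [g] on the ideal generated by [a_1 .. a_n] does
    not extend, a character of [E^n] killing all [(a_i e)_i] but not
    [(g a_i)_i] is a nonzero element of [E^+ (x) I] that dies in [E^+ (x) R].

    Conversely let [Q = Hom_Z(R, Q/Z)]. The direct sum of copies of [Q] is pure in
    the injective product, so its dual is a retract of a flat module and (2)
    makes the direct sum injective. For a chain [I_n] with union [U], choosing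
    [q_n] in [Q] killed by [I_n] but not by [U] (unless [I_n = U]), the map
    [x |-> (x q_n)_n] from [U] to the direct sum extends to [R], so [U = I_N] for
    some [N].

    For the envelope, an endomorphism [h] of [E] is bijective as soon as
    [h^+] is. *)

(** * Submodules and Baer's criterion *)

Definition mk_linear (R : pzRingType) (A B : lmodType R) (f : A -> B)
    (lin_f : linear f) : {linear A -> B} :=
  HB.pack f (GRing.isLinear.Build R A B *:%R f lin_f).

Section Submodules.
Variables (R : pzRingType) (V : lmodType R).

Record submodule := Submodule {
  submod_pred :> V -> Prop;
  submod0 : submod_pred 0;
  submodD : forall x y, submod_pred x -> submod_pred y -> submod_pred (x + y);
  submodZ : forall (r : R) x, submod_pred x -> submod_pred (r *: x) }.

Lemma submodB (U : submodule) x y : U x -> U y -> U (x - y).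
Proof. by move=> Ux Uy; rewrite -scaleN1r; apply/submodD/submodZ. Qed.

Lemma submod_sum (U : submodule) (I : Type) (s : seq I) (F : I -> V) :
  (forall i, U (F i)) -> U (\sum_(i <- s) F i).
Proof. by move=> UF; elim/big_ind: _ => // [|x y]; [exact: submod0 | exact: submodD]. Qed.

Variable U : submodule.

Definition submod_bool : {pred V} := fun x => `[< U x >].

Fact submod_bool_closed : GRing.subsemimod_closed submod_bool.
Proof.
split; first split.
- exact/asboolP/submod0.
- by move=> x y /asboolP Ux /asboolP Uy; apply/asboolP/submodD.
- by move=> r x /asboolP Ux; apply/asboolP/submodZ.
Qed.

Record submod_type := SubmodType { submod_val : V; _ : submod_val \in submod_bool }.

HB.instance Definition _ := [isSub for submod_val].
HB.instance Definition _ := [Choice of submod_type by <:].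
HB.instance Definition _ :=
  GRing.isSubmodClosed.Build R V submod_bool submod_bool_closed.
HB.instance Definition _ := [SubChoice_isSubLmodule of submod_type by <:].

Definition submod_elt x (Ux : U x) : submod_type := SubmodType (introT (asboolP _) Ux).

Lemma submod_valP (x : submod_type) : U (submod_val x).
Proof. by case: x => x /= /asboolP. Qed.

Lemma submod_val_linear : linear submod_val.
Proof. by []. Qed.

Definition submod_inc : {linear submod_type -> V} := mk_linear submod_val_linear.

Lemma submod_inc_inj : injective submod_inc.
Proof. exact: (@val_inj _ _ submod_type). Qed.

End Submodules.

(* Linear maps are handled through their graphs, as submodules of [B * E]:
   the partial maps of Zorn's lemma then need no subtypes. *)
Definition functional (R : pzRingType) (B E : lmodType R) (G : B * E -> Prop) :=
  forall e, G (0, e) -> e = 0.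

Section Baer.
Variables (R : pzRingType) (E : lmodType R).

(** A map on a left ideal is kept as a total function constrained only on [I], which spares subtypes
    when the criterion is checked. *)
Definition baer := forall (I : submodule R^o) (g : R -> E),
  (forall x y : R, I x -> I y -> g (x + y) = g x + g y) ->
  (forall r x : R, I x -> g (r * x) = r *: g x) ->
  exists e, forall x : R, I x -> g x = x *: e.

Lemma ideal_map_linear (I : submodule R^o) (g : R -> E) :
  (forall x y : R, I x -> I y -> g (x + y) = g x + g y) ->
  (forall r x : R, I x -> g (r * x) = r *: g x) ->
  linear (fun x : submod_type I => g (submod_val x)).
Proof.
move=> gD gZ r x y /=; rewrite gD ?gZ //; try exact: submod_valP.
exact: (@submodZ _ _ I r _ (submod_valP x)).
Qed.

Lemma injective_baer : injective_mod E -> baer.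
Proof.
move=> injE I g gD gZ.
have [h hE] :=
  injE _ _ (submod_inc I) (@submod_inc_inj _ _ I) (mk_linear (ideal_map_linear gD gZ)).
exists (h 1) => x Ix; rewrite -(linearZ_LR h x 1).
have := hE (submod_elt Ix) => /= <-; congr (h _).
by rewrite /= /GRing.scale /= mulr1.
Qed.

Lemma functional_eq (B : lmodType R) (G : submodule (B * E)%type) :
  functional G -> forall b e e', G (b, e) -> G (b, e') -> e = e'.
Proof.
move=> fG b e e' Ge Ge'; apply/eqP; rewrite -subr_eq0; apply/eqP/fG.
by rewrite -(subrr b); exact: (submodB Ge Ge').
Qed.

Section Extension.
Hypothesis baerE : baer.
Variables (B : lmodType R).

(** The scalars sending [y] into the domain of [G] form a left ideal, on which [G] induces a map.
    Baer's criterion makes this map multiplication by some [c], a consistent value at [y]. *)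
Lemma functional_extend1 (G : submodule (B * E)%type) (y : B) :
  functional G ->
  exists H : submodule (B * E)%type,
    [/\ functional H, forall p, G p -> H p & exists e, H (y, e)].
Proof.
move=> fG.
pose I0 := fun r : R^o => exists e, G ((r : R) *: y, e).
have I00 : I0 0 by exists 0; rewrite scale0r; exact: (submod0 G).
have I0D r s : I0 r -> I0 s -> I0 (r + s).
  by case=> e Ge [e' Ge']; exists (e + e'); rewrite scalerDl; exact: (submodD Ge Ge').
have I0Z (r : R) s : I0 s -> I0 (r *: s).
  by case=> e Ge; exists (r *: e); rewrite -scalerA; exact: (submodZ r Ge).
pose I := Submodule I00 I0D I0Z.
pose g (r : R) : E :=
  if pselect (exists e, G (r *: y, e)) is left ex
  then proj1_sig (cid ex) else 0.
have gP r e : G (r *: y, e) -> g r = e.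
  rewrite /g => Ge; case: pselect => [ex|]; last by case; exists e.
  by case: (cid ex) => e' /= /(functional_eq fG); exact.
have [||c cE] := @baerE I g.
- move=> r s [e Ge] [e' Ge']; rewrite (gP r e) // (gP s e') //.
  by apply: gP; rewrite scalerDl; exact: (submodD Ge Ge').
- move=> r s [e Ge]; rewrite (gP s e) //; apply: gP.
  by rewrite -scalerA; exact: (submodZ r Ge).
pose H0 (p : B * E) := exists r q, G q /\ p = (q.1 + r *: y, q.2 + r *: c).
have H00 : H0 0.
  exists 0, 0; split; first exact: submod0.
  by rewrite !scale0r !addr0.
have H0D p p' : H0 p -> H0 p' -> H0 (p + p').
  move=> [r [q [Gq ->]]] [r' [q' [Gq' ->]]].
  exists (r + r'), (q + q'); split; first exact: submodD.
  by rewrite !scalerDl; congr pair; rewrite /= addrACA.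
have H0Z (a : R) p : H0 p -> H0 (a *: p).
  move=> [r [q [Gq ->]]]; exists (a * r), (a *: q); split; first exact: submodZ.
  by rewrite -!scalerA; congr pair; rewrite /= scalerDr.
exists (Submodule H00 H0D H0Z); split=> /=.
- move=> e [r [[b e'] [/= Gq []]]] /esym /eqP; rewrite addr_eq0 => /eqP bE ->.
  (* If [b + r y = 0], then [G] already assigns [e'] to [- r y], so [e' = - r c] and the second
     component cancels too. *)
  have Gr : G ((- r) *: y, e') by rewrite scaleNr -bE.
  have := cE (- r); rewrite (gP _ _ Gr) => ->; last by exists e'.
  by rewrite scaleNr addNr.
- by move=> [b e] Gp; exists 0, (b, e); split=> //; rewrite /= !scale0r !addr0.
- exists c; exists 1, 0; split; first exact: submod0.
  by rewrite !scale1r /= !add0r.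
Qed.

Lemma functional_total (G : submodule (B * E)%type) :
  functional G -> exists h : {linear B -> E}, forall b e, G (b, e) -> h b = e.
Proof.
move=> fG.
(* The empty set is allowed so that the empty chain has an upper bound. *)
pose P (X : set (B * E)) := (forall p, ~ X p) \/
  exists K : submodule (B * E)%type,
    [/\ functional K, forall p, G p -> K p & X = K].
have [|X [PX maxX]] := @Zorn_bigcup _ P.
  move=> F FP Ftot.
  have [[X0 FX0 [p0 X0p0]]|F0] := pselect (exists2 X, F X & exists p, X p); last first.
    by left=> p [X FX Xp]; apply: F0; exists X => //; exists p.
  right; pose H0 p := exists2 X, F X & X p.
  have inK X p : F X -> X p -> exists K : submodule (B * E)%type,
      [/\ functional K, forall p, G p -> K p & X = K].
    by move=> FX Xp; case: (FP _ FX) => // X0'; case: (X0' p).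
  (* In a chain two elements share a member, from which closure and functionality are inherited. *)
  have two p q : H0 p -> H0 q -> exists K : submodule (B * E)%type,
      [/\ functional K, K p, K q & forall u, K u -> H0 u].
    move=> [X FX Xp] [Y FY Yq].
    have [Z [FZ Zp Zq]] : exists Z, [/\ F Z, Z p & Z q].
      by case: (Ftot X Y FX FY) => XY; [exists Y | exists X]; split=> //; exact: XY.
    have [K [fK _ ZK]] := inK Z p FZ Zp.
    by exists K; split=> //; rewrite -ZK // => u Zu; exists Z.
  have G0 p : G p -> H0 p.
    by move=> Gp; have [K [_ GK XK]] := inK X0 p0 FX0 X0p0; exists X0 => //; rewrite XK; exact: GK.
  have H0D p q : H0 p -> H0 q -> H0 (p + q).
    by move=> Hp Hq; have [K [_ Kp Kq]] := two p q Hp Hq; apply; exact: submodD.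
  have H0Z (r : R) p : H0 p -> H0 (r *: p).
    by move=> Hp; have [K [_ Kp _]] := two p p Hp Hp; apply; exact: submodZ.
  exists (Submodule (G0 _ (submod0 G)) H0D H0Z); split=> //.
  by move=> e He; have [K [fK Ke _ _]] := two _ _ He He; exact: fK.
have [K [fK GK maxK]] : exists K : submodule (B * E)%type,
    [/\ functional K, forall p, G p -> K p &
      forall H : submodule (B * E)%type,
        functional H -> (forall p, K p -> H p) -> forall p, H p -> K p].
  have max (H : submodule (B * E)%type) : functional H -> (forall p, G p -> H p) ->
      (forall p, X p -> H p) -> forall p, H p -> X p.
    move=> fH GH XH p Hp; apply: contrapT => Xp; apply: (maxX H); last first.
      by right; exists H.
    by split=> // HX; exact/Xp/HX.
  case: PX => [X0|[K [fK GK XK]]]; last first.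
    exists K; split=> // H fH KH p Hp; rewrite -XK; apply: (max H) => //.
      by move=> q /GK /KH.
    by rewrite XK.
  (* The empty set is not maximal: [G] is admissible and contains 0. *)
  exfalso; apply: (X0 0); apply: (max G) => //; first by move=> p /X0.
  exact: submod0.
have tot b : exists e, K (b, e).
  have [H [fH KH [e He]]] := functional_extend1 b fK.
  by exists e; exact: maxK He.
pose h b := proj1_sig (cid (tot b)).
have hE b e : K (b, e) -> h b = e.
  by rewrite /h; case: cid => e' /= Ke' Ke; exact: functional_eq Ke' Ke.
have Kh b : K (b, h b) by rewrite /h; case: cid.
have lin_h : linear h.
  by move=> r x y; apply: hE; exact: (submodD (submodZ r (Kh x)) (Kh y)).
by exists (mk_linear lin_h) => b e /GK; exact: hE.
Qed.

End Extension.

Lemma baer_injective : baer -> injective_mod E.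
Proof.
move=> baerE A B i inj_i g.
pose G0 (p : B * E) := exists a, p = (i a, g a).
have G00 : G0 0 by exists 0; rewrite !linear0.
have G0D p q : G0 p -> G0 q -> G0 (p + q).
  by move=> [a ->] [b ->]; exists (a + b); rewrite !linearD.
have G0Z (r : R) p : G0 p -> G0 (r *: p).
  by move=> [a ->]; exists (r *: a); rewrite !linearZ.
have [|h hE] := @functional_total baerE _ (Submodule G00 G0D G0Z).
  by move=> e [a [/esym/eqP]]; rewrite -(linear0 i) => /eqP/inj_i -> ->; rewrite linear0.
by exists h => a; apply: hE; exists a.
Qed.

End Baer.

(** * Characters of abelian groups *)

(** Division with remainder by the least positive element; [d = 0] accounts for the zero ideal. *)
Lemma int_ideal_principal (I : submodule int^o) :
  exists d : nat, forall n : int, I n <-> (d %| n)%Z.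
Proof.
have IN (n : int) : I n -> I (- n : int).
  by move=> In; rewrite -[- n]mulN1r; exact: (submodZ (-1 : int) In).
have Iabs (n : int) : I n -> I (`|n|%N : int).
  by move=> In; case: (intP n) In => [|k|k] //; rewrite abszN => /IN; rewrite opprK.
have [[n In n0]|I0] := pselect (exists2 n : int, I n & n != 0); last first.
  exists 0%N => n; rewrite dvd0z; split=> [In|/eqP ->]; last exact: (submod0 I).
  by apply: contrapT => n0; apply: I0; exists n => //; exact/negP.
have ex : exists k : nat, (0 < k)%N && `[< I (k : int) >].
  by exists `|n|%N; rewrite absz_gt0 n0; exact/asboolP/Iabs.
case: (ex_minnP ex) => d /andP [d0 /asboolP Id] dmin.
exists d => m; split=> [Im|/dvdzP [q ->]]; last exact: (submodZ (q : int) Id).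
have Ir : I ((m %% d)%Z : int).
  by rewrite /modz; exact: (submodB Im (submodZ ((m %/ d)%Z : int) Id)).
have d0' : (d : int) != 0 by rewrite -lt0n in d0 *.
have r0 := modz_ge0 m d0'.
have rd : (m %% d)%Z < d by rewrite ltz_pmod // lt0n_neq0.
apply/dvdz_mod0P; case: (m %% d)%Z r0 rd Ir => // k _ kd Ik.
case: k kd Ik => // k; rewrite ltz_nat ltnNge => /negP kd Ik; case: kd.
by apply: dmin; exact/asboolP.
Qed.

Lemma qzD x y : qz (x + y) = qz x + qz y.
Proof. by apply: qz_eq => /=; rewrite fr_frl fr_frr. Qed.

Lemma qzMn x n : qz (x *+ n) = qz x *+ n.
Proof.
elim: n => [|n IH]; first by rewrite !mulr0n.
by rewrite !mulrS qzD IH.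
Qed.

Lemma QZ_divisible (q : QZ) (n : nat) : (0 < n)%N -> exists p : QZ, p *+ n = q.
Proof.
move=> n0; exists (qz (val q / n%:R)).
rewrite -qzMn -[_ / _ *+ _]mulr_natr mulfVK ?pnatr_eq0 -?lt0n //.
exact: qzK.
Qed.

Lemma QZ_torsion (n : nat) : (1 < n)%N -> exists2 p : QZ, p != 0 & p *+ n = 0.
Proof.
move=> n1; have n0 : (0 : rat) < n%:R by rewrite ltr0n ltnW.
exists (qz n%:R^-1); last first.
  rewrite -qzMn -[_^-1 *+ _]mulr_natr mulVf ?gt_eqF //; apply: qz_eq.
  by rewrite -[1]add0r (fr_addz 0 1).
apply/eqP => /(congr1 val) /=; rewrite /fr floor0 subr0.
have -> : Num.floor (n%:R^-1 : rat) = 0.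
  by apply/floor_def; rewrite invr_ge0 ltW //= invf_lt1 // ltr1n.
by rewrite !subr0 => /eqP; rewrite invr_eq0 gt_eqF.
Qed.

(** Ideals of the integers are principal, so extending a map only requires dividing its value at a
    generator. *)
Lemma QZ_baer : baer (zmodule QZ : lmodType int).
Proof.
move=> I g gD gZ; have [d Id] := int_ideal_principal I.
have dI : I (d : int) by apply/Id.
have [d0|d0] := posnP d.
  exists 0 => x /Id; rewrite d0 dvd0z => /eqP ->; rewrite scaler0.
  by have := gZ 0 0 (submod0 I); rewrite mul0r scale0r.
have [p pE] := QZ_divisible (g d) d0.
exists p => x /Id /dvdzP [q ->]; rewrite gZ // -pE.
by rewrite -scalerA.
Qed.

Section Characters.
Variable G : zmodType.

Lemma zadditive0 (f : G -> QZ) : zadditive f -> f 0 = 0.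
Proof. by move=> fD; apply: (addrI (f 0)); rewrite -fD !addr0. Qed.

Lemma zadditiveN (f : G -> QZ) : zadditive f -> {morph f : x / - x}.
Proof.
by move=> fD x; apply: (addrI (f x)); rewrite -fD !subrr zadditive0.
Qed.

Lemma zadditive_sum (f : G -> QZ) (I : Type) (s : seq I) (F : I -> G) :
  zadditive f -> f (\sum_(i <- s) F i) = \sum_(i <- s) f (F i).
Proof. by move=> fD; elim/big_ind2: _ => [|x ? y ? <- <-|//]; rewrite ?zadditive0. Qed.

(** Injectivity of [QZ] over [int], with a partial character given by its graph [H]; closure under
    integer multiples comes from sums and opposites. *)
Lemma char_total (H : G -> QZ -> Prop) :
    H 0 0 -> (forall x y p q, H x p -> H y q -> H (x + y) (p + q)) ->
    (forall x p, H x p -> H (- x) (- p)) -> (forall q, H 0 q -> q = 0) ->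
  exists2 chi : G -> QZ, zadditive chi & forall x q, H x q -> chi x = q.
Proof.
move=> H0 HD HN fH.
pose K (p : zmodule G * zmodule QZ) := H p.1 p.2.
have Kn (n : nat) p : K p -> K (p *+ n).
  by move=> Kp; elim: n => [|n IH]; rewrite ?mulr0n // mulrS; exact: HD.
have KZ (z : int) p : K p -> K (z *: p).
  move=> Kp.
  have -> : z *: p = p *~ z by rewrite -scaler_int intz.
  case: z => n /=; rewrite ?NegzE /=; first exact: Kn.
  by apply: HN; exact: Kn.
have KD p q : K p -> K q -> K (p + q) by exact: HD.
have [e He|h hE] := @functional_total _ _ QZ_baer _ (@Submodule int _ K H0 KD KZ).
  exact: fH.
exists h => [x y|x q]; [exact: linearD h x y | exact: hE].
Qed.

(** The character is first defined on the subgroup generated by [H] and [x], as zero on [H] and a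
    nonzero [c] at [x], then extended. *)
Lemma char_separate (H : G -> Prop) x :
    H 0 -> (forall x y, H x -> H y -> H (x + y)) -> (forall x, H x -> H (- x)) ->
    ~ H x ->
  exists2 chi : G -> QZ, zadditive chi & (forall y, H y -> chi y = 0) /\ chi x <> 0.
Proof.
move=> H0 HD HN Hx.
have Hn (n : nat) y : H y -> H (y *+ n).
  by move=> Hy; elim: n => [|n IH]; rewrite ?mulr0n // mulrS; exact: HD.
have Hz (z : int) y : H y -> H (y *~ z).
  by move=> Hy; case: z => n; [exact: Hn | exact/HN/Hn].
pose I0 (z : int^o) := H (x *~ z).
have I00 : I0 0 by rewrite /I0 mulr0z.
have I0D z t : I0 z -> I0 t -> I0 (z + t) by rewrite /I0 mulrzDr; exact: HD.
have I0Z (z : int) t : I0 t -> I0 (z *: t).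
  by rewrite /I0 /GRing.scale /= mulrC mulrzA => /(Hz z).
have [d Id] := int_ideal_principal (Submodule I00 I0D I0Z).
(* [d] is the order of [x] modulo [H], with 0 for infinite order, so [c] must be killed by [d];
   [d = 1] would put [x] in [H]. *)
have [c c0 cd] : exists2 c : QZ, c != 0 & c *+ d = 0.
  case: d Id => [|[|d]] Id.
  - by have [c c0 _] := @QZ_torsion 2 isT; exists c.
  - by case: Hx; rewrite -[x]mulr1z; apply/(Id 1).
  - exact: QZ_torsion.
pose K y q := exists h (z : int), [/\ H h, y = h + x *~ z & q = c *~ z].
have [||||chi chiD chiE] := @char_total K.
- by exists 0, 0; rewrite !mulr0z addr0.
- move=> _ _ _ _ [h [z [Hh -> ->]]] [h' [z' [Hh' -> ->]]].
  exists (h + h'), (z + z'); rewrite !mulrzDr addrACA; split=> //; exact: HD.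
- move=> _ _ [h [z [Hh -> ->]]]; exists (- h), (- z).
  by rewrite !mulrNz opprD; split=> //; exact: HN.
- move=> q [h [z [Hh /esym/eqP]]]; rewrite addr_eq0 => /eqP hE ->.
  have /Id /dvdzP [t ->] : I0 z.
    by rewrite /I0 -[x *~ z]opprK -hE; exact: HN.
  by rewrite mulrC mulrzA /= [c *~ _]cd mul0rz.
exists chi => //; split=> [y Hy|].
  by apply: chiE; exists y, 0; rewrite !mulr0z addr0.
have -> : chi x = c by apply: chiE; exists 0, 1; rewrite !mulr1z add0r.
exact/eqP.
Qed.


End Characters.

(** The kernel condition makes [f x |-> phi x] well defined on the image of [f], from where it
    extends. *)
Lemma char_factor (G K : zmodType) (f : {additive G -> K}) (phi : G -> QZ) :
    zadditive phi -> (forall x, f x = 0 -> phi x = 0) ->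
  exists2 psi : K -> QZ, zadditive psi & forall x, psi (f x) = phi x.
Proof.
move=> phiD kerf.
have [||||psi psiD psiE] := @char_total K (fun y q => exists2 x, y = f x & q = phi x).
- by exists 0; rewrite ?raddf0 ?zadditive0.
- by move=> _ _ _ _ [x -> ->] [y -> ->]; exists (x + y); rewrite ?raddfD ?phiD.
- by move=> _ _ [x -> ->]; exists (- x); rewrite ?raddfN ?zadditiveN.
- by move=> _ [x /esym /kerf -> ->].
by exists psi => // x; apply: psiE; exists x.
Qed.

(** * Tensor products *)

Section TensorRelation.
Variables (R : pzRingType) (M : lmodType R^c) (A : lmodType R).
Implicit Types (s t : seq (M * A)).

Record balanced (b : M -> A -> QZ) : Prop := Balanced {
  balancedDl : forall m m' a, b (m + m') a = b m a + b m' a;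
  balancedDr : forall m a a', b m (a + a') = b m a + b m a';
  balancedZ : forall (r : R) m a, b ((r : R^c) *: m) a = b m (r *: a) }.

Definition tensor_eval (b : M -> A -> QZ) s := \sum_(p <- s) b p.1 p.2.

Lemma tequiv_eval b s t : balanced b -> tequiv s t -> tensor_eval b s = tensor_eval b t.
Proof.
move=> [bDl bDr bZ]; elim; rewrite /tensor_eval.
- by [].
- by [].
- by move=> ? ? ? _ -> _ ->.
- by move=> *; exact: perm_big.
- by move=> ? ? ? ? _ e _ e'; rewrite !big_cat /= e e'.
- by move=> *; rewrite !big_cons !big_nil /= bDl !addr0.
- by move=> *; rewrite !big_cons !big_nil /= bDr !addr0.
- by move=> *; rewrite !big_cons !big_nil /= bZ.
- move=> a; rewrite !big_cons !big_nil /= addr0.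
  by apply: (addrI (b 0 a)); rewrite -bDl !addr0.
Qed.

Lemma tensor_zero_eval b s : balanced b -> tensor_zero s -> tensor_eval b s = 0.
Proof. by move=> bb /(tequiv_eval bb) ->; rewrite /tensor_eval big_nil. Qed.

Lemma tequiv_zero_r (m : M) : @tequiv R M A [:: (m, 0)] [::].
Proof.
have := te_bal 0 m (0 : A); rewrite !scale0r => /te_sym e.
exact: te_trans e (te_zero _ _).
Qed.

Definition tensor_opp s := [seq (- p.1, p.2) | p <- s].

Lemma tequiv_opp s t : tequiv s t -> tequiv (tensor_opp s) (tensor_opp t).
Proof.
elim; rewrite /tensor_opp.
- by move=> *; exact: te_refl.
- by move=> *; exact: te_sym.
- by move=> ? ? ? _ e _ e'; exact: te_trans e e'.
- by move=> *; exact/te_perm/perm_map.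
- by move=> ? ? ? ? _ e _ e'; rewrite !map_cat; exact: te_cat.
- by move=> m m' a /=; rewrite opprD; exact: te_addl.
- by move=> *; exact: te_addr.
- by move=> r m a /=; rewrite -scalerN; exact: te_bal.
- by move=> a /=; rewrite oppr0; exact: te_zero.
Qed.

Lemma tequiv_oppK s : tequiv (tensor_opp s ++ s) [::].
Proof.
elim: s => [|[m a] s IH]; first exact: te_refl.
apply: (@te_trans _ _ _ _ ([:: (- m, a); (m, a)] ++ (tensor_opp s ++ s))).
  apply: te_perm; rewrite /= perm_cons -cat_rcons -[_ :: tensor_opp s ++ s]cat1s catA.
  by rewrite perm_cat2r -cats1 perm_catC.
apply: (te_cat (t1 := [::]) _ IH); apply: te_trans (te_sym (te_addl _ _ _)) _.
by rewrite addNr; exact: te_zero.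
Qed.

Definition tequivb s t := `[< tequiv s t >].

Lemma tequivb_refl : reflexive tequivb.
Proof. by move=> s; exact/asboolP/te_refl. Qed.
Lemma tequivb_sym : symmetric tequivb.
Proof. by move=> s t; apply/asboolP/asboolP => /te_sym. Qed.
Lemma tequivb_trans : transitive tequivb.
Proof. by move=> t s u /asboolP e /asboolP e'; exact/asboolP/(te_trans e e'). Qed.

Canonical tequivb_equiv := EquivRel tequivb tequivb_refl tequivb_sym tequivb_trans.

Definition tensor := {eq_quot tequivb_equiv}%qT.
HB.instance Definition _ := Choice.on tensor.
HB.instance Definition _ := Quotient.on tensor.

Definition tcls s : tensor := \pi_tensor%qT s.

Lemma tclsP s t : tcls s = tcls t <-> tequiv s t.
Proof.
by split=> [/eqmodP /asboolP|e] //; apply/eqmodP/asboolP.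
Qed.

Lemma repr_tequiv s : tequiv (repr (tcls s)) s.
Proof. by apply/tclsP; rewrite /tcls reprK. Qed.

Lemma tensorW (P : tensor -> Prop) : (forall s, P (tcls s)) -> forall x, P x.
Proof. by move=> Pt x; rewrite -(reprK x). Qed.

Definition tens_add (x y : tensor) := tcls (repr x ++ repr y).
Definition tens_opp (x : tensor) := tcls (tensor_opp (repr x)).

Lemma tens_addE s t : tens_add (tcls s) (tcls t) = tcls (s ++ t).
Proof. by apply/tclsP/te_cat; exact: repr_tequiv. Qed.

Lemma tens_oppE s : tens_opp (tcls s) = tcls (tensor_opp s).
Proof. exact/tclsP/tequiv_opp/repr_tequiv. Qed.

Lemma tens_addA : associative tens_add.
Proof. by elim/tensorW => s; elim/tensorW => t; elim/tensorW => u; rewrite !tens_addE catA. Qed.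
Lemma tens_addC : commutative tens_add.
Proof.
elim/tensorW => s; elim/tensorW => t; rewrite !tens_addE; apply/tclsP/te_perm.
by rewrite perm_catC.
Qed.
Lemma tens_add0 : left_id (tcls [::]) tens_add.
Proof. by elim/tensorW => s; rewrite tens_addE. Qed.
Lemma tens_addN : left_inverse (tcls [::]) tens_opp tens_add.
Proof. by elim/tensorW => s; rewrite tens_oppE tens_addE; exact/tclsP/tequiv_oppK. Qed.

HB.instance Definition _ :=
  GRing.isZmodule.Build tensor tens_addA tens_addC tens_add0 tens_addN.

Lemma tclsD s t : tcls (s ++ t) = tcls s + tcls t.
Proof. by rewrite -tens_addE. Qed.

Lemma tcls_eq0 s : tcls s = 0 <-> tensor_zero s.
Proof. exact: tclsP. Qed.

Definition tens (m : M) (a : A) : tensor := tcls [:: (m, a)].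

Lemma tensDl m m' a : tens (m + m') a = tens m a + tens m' a.
Proof. by rewrite /tens -tclsD; apply/tclsP/te_addl. Qed.

Lemma tensDr m a a' : tens m (a + a') = tens m a + tens m a'.
Proof. by rewrite /tens -tclsD; apply/tclsP/te_addr. Qed.

Lemma tensZ (r : R) m a : tens ((r : R^c) *: m) a = tens m (r *: a).
Proof. exact/tclsP/te_bal. Qed.

Lemma tens0l a : tens 0 a = 0.
Proof. exact/tclsP/te_zero. Qed.

Lemma tens0r m : tens m 0 = 0.
Proof. exact/tclsP/tequiv_zero_r. Qed.

Lemma tens_suml (I : Type) (l : seq I) (m : I -> M) a :
  tens (\sum_(i <- l) m i) a = \sum_(i <- l) tens (m i) a.
Proof. by apply: (big_morph (tens^~ a)) => [x y|]; [exact: tensDl | exact: tens0l]. Qed.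

Lemma tens_sumr (I : Type) (l : seq I) m (a : I -> A) :
  tens m (\sum_(i <- l) a i) = \sum_(i <- l) tens m (a i).
Proof. by apply: (big_morph (tens m)) => [x y|]; [exact: tensDr | exact: tens0r]. Qed.

Lemma tcls_sum s : tcls s = \sum_(p <- s) tens p.1 p.2.
Proof.
elim: s => [|[m a] s IH]; first by rewrite big_nil.
by rewrite big_cons -IH -tclsD.
Qed.

Lemma balanced_tens (psi : tensor -> QZ) :
  zadditive psi -> balanced (fun m a => psi (tens m a)).
Proof.
by move=> psiD; split=> *; rewrite -?psiD -?tensDl -?tensDr ?tensZ.
Qed.

(** Converse of [balanced_tens]: equivalent formal sums have equal evaluations, so the choice of
    representative is harmless. *)
Lemma tensor_eval_zadditive b :
  balanced b -> zadditive (fun x : tensor => tensor_eval b (repr x)).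
Proof.
move=> bb x y; rewrite [LHS](tequiv_eval bb (repr_tequiv _)).
by rewrite /tensor_eval big_cat.
Qed.

End TensorRelation.

Section TensorMap.
Variables (R : pzRingType) (M N : lmodType R^c) (A B : lmodType R).
Variables (u : {linear M -> N}) (g : {linear A -> B}).

Definition tensor_map (s : seq (M * A)) := [seq (u p.1, g p.2) | p <- s].

Lemma tequiv_map s t : tequiv s t -> tequiv (tensor_map s) (tensor_map t).
Proof.
elim; rewrite /tensor_map.
- by move=> *; exact: te_refl.
- by move=> *; exact: te_sym.
- by move=> ? ? ? _ e _ e'; exact: te_trans e e'.
- by move=> *; exact/te_perm/perm_map.
- by move=> ? ? ? ? _ e _ e'; rewrite !map_cat; exact: te_cat.
- by move=> m m' a /=; rewrite linearD; exact: te_addl.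
- by move=> m a a' /=; rewrite linearD; exact: te_addr.
- by move=> r m a /=; rewrite !linearZ; exact: te_bal.
- by move=> a /=; rewrite linear0; exact: te_zero.
Qed.

End TensorMap.

(** [b] is a character of [M (x) A], and [M (x) A -> M (x) B] has zero kernel, so [char_factor]
    applies. The hypothesis concerns the single map [g], to cover both flat [M] and pure
    submodules. *)
Lemma balanced_extend (R : pzRingType) (M : lmodType R^c) (A B : lmodType R)
    (g : {linear A -> B}) (b : M -> A -> QZ) :
    (forall s : seq (M * A),
      tensor_zero [seq (p.1, g p.2) | p <- s] -> tensor_zero s) ->
    balanced b ->
  exists2 b' : M -> B -> QZ, balanced b' & forall m a, b' m (g a) = b m a.
Proof.
move=> gK bb.
pose f (x : tensor M A) : tensor M B := tcls (tensor_map idfun g (repr x)).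
have fE s : f (tcls s) = tcls (tensor_map idfun g s).
  exact/tclsP/tequiv_map/repr_tequiv.
have fD : nmod_morphism f.
  split; first by rewrite (fE [::]).
  by elim/tensorW => s; elim/tensorW => t; rewrite -tclsD !fE -tclsD /tensor_map map_cat.
pose f' : {additive tensor M A -> tensor M B} :=
  HB.pack f (GRing.isNmodMorphism.Build _ _ f fD).
have [|psi psiD psiE] := @char_factor _ _ f' _ (tensor_eval_zadditive bb).
  elim/tensorW => s; rewrite /= fE => /tcls_eq0 /gK s0.
  rewrite (tequiv_eval bb (repr_tequiv _)); exact: tensor_zero_eval.
exists (fun m x => psi (tens m x)); first exact: balanced_tens.
move=> m a; have := psiE (tens m a); rewrite /= fE /= => ->.
by rewrite (tequiv_eval bb (repr_tequiv _)) /tensor_eval big_seq1.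
Qed.

(** A tensor is pushed along [i], seen to vanish over [N], and brought back by [p]. *)
Lemma flat_mod_retract (R : pzRingType) (M N : lmodType R^c)
    (i : {linear M -> N}) (p : {linear N -> M}) :
  cancel i p -> flat_mod N -> flat_mod M.
Proof.
move=> iK flN A B g inj_g s /(tequiv_map i idfun) s0.
have: tensor_zero (tensor_map i idfun s).
  apply: (flN _ _ g inj_g); rewrite /tensor_map -map_comp.
  by move: s0; rewrite /tensor_map -map_comp.
move=> /(tequiv_map p idfun); rewrite /tensor_map -map_comp /=.
by congr tequiv; rewrite -[RHS]map_id; apply: eq_map => -[m a] /=; rewrite iK.
Qed.

(** * Character modules *)

Section CharacterModules.
Variable R : pzRingType.

Lemma charfunD (E : lmodType R) (phi : charmod E) : zadditive (charfun phi).
Proof. exact: (proj2_sig phi). Qed.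

Lemma balanced_charfun (A E : lmodType R) (h : {linear A -> E}) :
  balanced (fun (phi : charmod E) a => charfun phi (h a)).
Proof.
split=> [//|phi a a'|r phi a]; last by rewrite linearZ.
by rewrite linearD charfunD.
Qed.

Lemma balanced_dual (A : lmodType R) (M : lmodType R^c) (h : {linear M -> charmod A}) :
  balanced (fun m a => charfun (h m) a).
Proof.
split=> [m m' a|m a a'|r m a]; first by rewrite linearD.
  exact: charfunD.
by rewrite linearZ.
Qed.

(** With [balanced_dual], this is the adjunction identifying maps [M -> A^+] with characters of
    [M (x) A]. *)
Lemma balanced_linear (A : lmodType R) (M : lmodType R^c) (b : M -> A -> QZ) :
  balanced b -> exists h : {linear M -> charmod A}, forall m a, charfun (h m) a = b m a.
Proof.
move=> bb; pose h m : charmod A := exist _ _ (balancedDr bb m).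
have lin_h : linear h.
  by move=> r x y; apply: charmod_ext => a /=; rewrite (balancedDl bb) (balancedZ bb).
by exists (mk_linear lin_h).
Qed.

Lemma char_sum (E : lmodType R) (I : Type) (l : seq I) (F : I -> charmod E) x :
  charfun (\sum_(i <- l) F i) x = \sum_(i <- l) charfun (F i) x.
Proof. by elim/big_ind2: _ => [|? phi ? psi <- <-|]. Qed.

Lemma dualmap_linear (A E : lmodType R) (f : {linear A -> E}) : linear (dualmap f).
Proof. by move=> r phi psi; apply: charmod_ext => a /=; rewrite linearZ. Qed.

(** By adjunction, lifting [g] through [f^+] amounts to extending a character from [G (x) A] to
    [G (x) E]. *)
Lemma flat_lift (A E : lmodType R) (f : {linear A -> E}) (G : lmodType R^c)
    (g : {linear G -> charmod A}) :
    injective f -> flat_mod G ->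
  exists h : {linear G -> charmod E}, forall x, dualmap f (h x) = g x.
Proof.
move=> inj_f flG.
have [b bb bE] := balanced_extend (flG _ _ f inj_f) (balanced_dual g).
have [h hE] := balanced_linear bb.
by exists h => x; apply: charmod_ext => a /=; rewrite hE bE.
Qed.

Section Coordinates.
Variables (E : lmodType R) (n : nat).

Definition single (i : 'I_n) (x : E) : 'I_n -> E := fun j => if j == i then x else 0.

Lemma singleD i : {morph single i : x y / x + y}.
Proof. by move=> x y; apply/funext => j; rewrite /single !fctE; case: eqP; rewrite ?addr0. Qed.

Lemma sum_single (e : 'I_n -> E) : e = \sum_i single i (e i).
Proof.
apply/funext => j; rewrite fct_sumE (bigD1 j) //= /single eqxx big1 ?addr0 //.
by move=> i; rewrite eq_sym => /negPf ->.
Qed.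

Variables (chi : ('I_n -> E) -> QZ) (chiD : zadditive chi).

Lemma char_coord_zadditive i : zadditive (fun x => chi (single i x)).
Proof. by move=> x y; rewrite singleD chiD. Qed.

Definition char_coord i : charmod E := exist _ _ (char_coord_zadditive i).

Lemma char_coordE (e : 'I_n -> E) : chi e = \sum_i charfun (char_coord i) (e i).
Proof. by rewrite {1}(sum_single e) zadditive_sum. Qed.

End Coordinates.

(** A character killing the image of [h] but not [y] would be a nonzero element of the kernel of
    [h^+]. *)
Lemma dual_inj_surj (A E : lmodType R) (h : {linear A -> E}) :
  injective (dualmap h) -> forall y, exists x, h x = y.
Proof.
move=> inj_h y; apply: contrapT => hy.
have [||||chi chiD [chi0 chiy]] := @char_separate E (fun y => exists x, h x = y) y.
- by exists 0; rewrite linear0.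
- by move=> _ _ [x <-] [x' <-]; exists (x + x'); rewrite linearD.
- by move=> _ [x <-]; exists (- x); rewrite linearN.
- exact: hy.
apply: chiy; pose phi : charmod E := exist _ chi chiD.
suff -> : chi = charfun 0 by [].
have /inj_h <- // : dualmap h phi = dualmap h 0.
by apply: charmod_ext => x; apply: chi0; exists x.
Qed.

(** A character nonzero at [x] factors through [h], so [h x] cannot be 0. *)
Lemma dual_surj_inj (A E : lmodType R) (h : {linear A -> E}) :
  (forall phi, exists psi, dualmap h psi = phi) -> injective h.
Proof.
move=> surj_h; apply: raddf_inj => x hx; apply: contrapT => x0.
have [||||chi chiD [_ chix]] := @char_separate A (fun y => y = 0) x => //.
- by move=> _ _ -> ->; rewrite addr0.
- by move=> _ ->; rewrite oppr0.
have [psi psiE] := surj_h (exist _ chi chiD : charmod A).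
apply: chix; have <- : charfun (dualmap h psi) x = chi x by rewrite psiE.
by rewrite /= hx (zadditive0 (charfunD psi)).
Qed.

Lemma dual_bij (A E : lmodType R) (h : {linear A -> E}) :
  bijective (dualmap h) -> bijective h.
Proof.
move=> [k hK kK].
have inj_h : injective h by apply: dual_surj_inj => phi; exists (k phi).
have surj_h := dual_inj_surj (can_inj hK).
pose g y := proj1_sig (cid (surj_h y)).
have gK : cancel g h by move=> y; rewrite /g; case: cid.
by exists g => // x; apply: inj_h; rewrite gK.
Qed.

End CharacterModules.

(** * Finitely generated submodules *)

Section FiniteGeneration.
Variables (R : pzRingType) (V : lmodType R).
Implicit Types (s : seq V).

Definition lcomb s x := exists c : nat -> R, x = \sum_(i < size s) c i *: s`_i.

Fact lcomb0 s : lcomb s 0.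
Proof. by exists (fun _ => 0); rewrite big1 // => i _; rewrite scale0r. Qed.
Fact lcombD s x y : lcomb s x -> lcomb s y -> lcomb s (x + y).
Proof.
move=> [c ->] [d ->]; exists (fun i => c i + d i); rewrite -big_split.
by apply: eq_bigr => i _; rewrite scalerDl.
Qed.
Fact lcombZ s (r : R) x : lcomb s x -> lcomb s (r *: x).
Proof.
move=> [c ->]; exists (fun i => r * c i); rewrite scaler_sumr.
by apply: eq_bigr => i _; rewrite scalerA.
Qed.
Definition lspan s := Submodule (lcomb0 s) (@lcombD s) (@lcombZ s).

Lemma mem_lspan s x : x \in s -> lspan s x.
Proof.
move=> sx; exists (fun i => (i == index x s)%:R).
have lt_x : (index x s < size s)%N by rewrite index_mem.
rewrite (bigD1 (Ordinal lt_x)) //= eqxx scale1r nth_index // big1 ?addr0 //.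
by move=> i /negPf; rewrite -val_eqE /= => ->; rewrite scale0r.
Qed.

Lemma lspan_min (U : submodule V) s x :
  (forall y, y \in s -> U y) -> lspan s x -> U x.
Proof.
move=> sU [c ->]; apply: submod_sum => i; apply: submodZ.
by apply: sU; rewrite mem_nth.
Qed.

Definition fingen (U : submodule V) :=
  exists2 s, forall x, x \in s -> U x & forall x, U x -> lspan s x.

End FiniteGeneration.

(** Otherwise, repeatedly adjoining an element of [I] outside the current span gives a chain that
    never stops growing. *)
Lemma noetherian_fingen (R : pzRingType) :
  left_noetherian R -> forall I : submodule R^o, fingen I.
Proof.
move=> noethR I; apply: contrapT => nfg.
(* The premise makes the choice total: a list not contained in [I] receives the dummy 0. *)
have ex (s : seq R^o) : exists x : R^o,
    (forall y, y \in s -> I y) -> I x /\ ~ lspan s x.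
  have [sI|sI] := pselect (forall y, y \in s -> I y); last by exists 0.
  apply: contrapT => nex; apply: nfg; exists s => // x Ix.
  by apply: contrapT => sx; apply: nex; exists x.
pose pick s := proj1_sig (cid (ex s)).
pose S n := iter n (fun s => pick s :: s) [::].
have SI n y : y \in S n -> I y.
  elim: n y => [//|n IH] y; rewrite inE => /orP [/eqP ->|]; last exact: IH.
  by rewrite /pick; case: cid => x /= /(_ IH) [].
have [||N stat] := noethR (fun n => lspan (S n)).
- move=> n; split=> [|x y|r x].
  + exact: (submod0 (lspan (S n))).
  + exact: (@submodD _ _ (lspan (S n)) x y).
  + exact: (@submodZ _ _ (lspan (S n)) r x).
- move=> n x; apply: lspan_min => y Sy; apply: mem_lspan.
  by rewrite inE Sy orbT.
have : lspan (S N) (pick (S N)).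
  by apply: (stat N.+1 (leqnSn N)); apply: mem_lspan; rewrite inE eqxx.
by rewrite /pick; case: cid => x /= /(_ (SI N)) [].
Qed.

(** Induction on a bound [n] from which coordinates vanish. The last possibly nonzero coordinates of
    elements of [K] form a left ideal; subtracting a combination of lifts of its generators lowers
    the bound. *)
Lemma noetherian_fingen_free (R : pzRingType) (m : nat) :
  left_noetherian R -> forall K : submodule ('I_m -> R^o), fingen K.
Proof.
move=> noethR K.
suff /(_ m) [s sK sgen] : forall n, exists2 s, forall x, x \in s -> K x &
    forall x, K x -> (forall i : 'I_m, (n <= i)%N -> x i = 0) -> lspan s x.
  by exists s => // x Kx; apply: sgen => // i; rewrite leqNgt ltn_ord.
elim=> [|n [s sK sgen]].
  exists [::] => // x _ x0; suff -> : x = 0 by exact: submod0.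
  by apply/funext => i; exact: x0.
have [lt_nm|le_mn] := ltnP n m; last first.
  exists s => // x Kx _; apply: sgen => // i le_ni.
  by have := ltn_ord i; rewrite ltnNge (leq_trans le_mn).
pose j := Ordinal lt_nm.
pose Q (x : 'I_m -> R^o) := K x /\ forall i : 'I_m, (n < i)%N -> x i = 0.
pose I0 (r : R^o) := exists2 x, Q x & x j = r.
have I00 : I0 0 by exists 0 => //; split; first exact: submod0.
have I0D r t : I0 r -> I0 t -> I0 (r + t).
  move=> [x [Kx x0] <-] [y [Ky y0] <-]; exists (x + y) => //; split; first exact: submodD.
  by move=> i ni; rewrite fctE x0 // y0 // addr0.
have I0Z (a : R) r : I0 r -> I0 (a *: r).
  move=> [x [Kx x0] <-]; exists (a *: x) => //; split; first exact: submodZ.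
  by move=> i ni; rewrite fctE x0 // scaler0.
have [t tI tgen] := noetherian_fingen noethR (Submodule I00 I0D I0Z).
have ex r : exists x, I0 r -> Q x /\ x j = r.
  have [[x Qx xr]|nI] := pselect (I0 r); first by exists x.
  by exists 0 => /nI.
pose L r := proj1_sig (cid (ex r)).
have LP r : I0 r -> Q (L r) /\ L r j = r by rewrite /L; case: cid.
exists (s ++ map L t) => [x|x Kx x0].
  by rewrite mem_cat => /orP [/sK //|/mapP [r /tI /LP [[KL _] _] ->]].
have [c xj] : lspan t (x j) by apply: tgen; exists x.
pose y := \sum_(i < size t) c i *: L t`_i.
have tiI (i : 'I_(size t)) : I0 t`_i by apply: tI; rewrite mem_nth.
have Uy : lspan (s ++ map L t) y.
  apply: submod_sum => i; apply: submodZ; apply: mem_lspan.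
  by rewrite mem_cat map_f ?orbT // mem_nth.
rewrite -(subrK y x); apply: submodD Uy.
apply: (@lspan_min _ _ _ s) => [z sz|]; first by apply: mem_lspan; rewrite mem_cat sz.
apply: sgen => [|i].
  apply: submodB => //; apply: submod_sum => i; apply: submodZ.
  by have [[]] := LP _ (tiI i).
rewrite leq_eqVlt => /orP [/eqP ni|ni].
  have -> : i = j by apply: val_inj.
  rewrite !fctE /y fct_sumE xj; apply/eqP; rewrite subr_eq0; apply/eqP.
  by apply: eq_bigr => k _; rewrite fctE; have [_ ->] := LP _ (tiI k).
rewrite !fctE /y fct_sumE x0 // big1 ?subrr // => k _.
by have [[_ Li] _] := LP _ (tiI k); rewrite fctE Li // scaler0.
Qed.

(** * Injective modules and flat character modules *)

Lemma injective_char_flat (R : pzRingType) (E : lmodType R) :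
  left_noetherian R -> injective_mod E -> flat_mod (charmod E).
Proof.
move=> noethR injE A B g inj_g s s0.
pose n := size s; pose phi (i : 'I_n) := (tnth (in_tuple s) i).1.
pose a (i : 'I_n) := (tnth (in_tuple s) i).2.
have sE : s = [seq (phi i, a i) | i <- index_enum 'I_n].
  rewrite -[LHS](map_tnth_enum (in_tuple s)) enumT; apply: eq_map => i.
  by rewrite /phi /a -surjective_pairing.
pose K0 (c : 'I_n -> R^o) := \sum_i (c i : R) *: a i = 0.
have K00 : K0 0 by rewrite /K0 big1 // => i _; rewrite scale0r.
have K0D c d : K0 c -> K0 d -> K0 (c + d).
  rewrite /K0 => c0 d0; under eq_bigr do rewrite scalerDl.
  by rewrite big_split /= c0 d0 addr0.
have K0Z (r : R) c : K0 c -> K0 (r *: c).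
  rewrite /K0 => c0; under eq_bigr do rewrite -scalerA.
  by rewrite -scaler_sumr c0 scaler0.
have [t tK tgen] := noetherian_fingen_free noethR (Submodule K00 K0D K0Z).
pose m := size t; pose r (j : 'I_m) (i : 'I_n) : R := t`_j i.
have ra j : \sum_i r j i *: a i = 0 by apply: tK; rewrite mem_nth.
(* The kernel of [rho] consists of the tuples satisfying every relation among the [a i]. *)
pose rho (e : 'I_n -> E) : 'I_m -> E := fun j => \sum_i r j i *: e i.
have rhoD : nmod_morphism rho.
  split=> [|e e']; apply/funext => j.
    by rewrite /rho big1 // => i _; rewrite scaler0.
  rewrite -[RHS]/(rho e j + rho e' j) /rho -big_split.
  by apply: eq_bigr => i _; rewrite scalerDr.
pose rho' : {additive ('I_n -> E) -> ('I_m -> E)} :=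
  HB.pack rho (GRing.isNmodMorphism.Build _ _ rho rhoD).
pose Phi (e : 'I_n -> E) := \sum_i charfun (phi i) (e i).
have PhiD : zadditive Phi.
  by move=> e e'; rewrite /Phi -big_split; apply: eq_bigr => i _; exact: charfunD.
(* A tuple [e] killed by the relations among the [a i] is the image of the
   [a i] under a map into [E], which extends to [B] by injectivity. *)
have Phi0 e : rho' e = 0 -> Phi e = 0.
  move=> /= e0.
  pose G0 (p : B * E) := exists c : 'I_n -> R,
    p = (\sum_i c i *: g (a i), \sum_i c i *: e i).
  have G00 : G0 0.
    by exists (fun _ => 0); rewrite !big1 // => i _; rewrite scale0r.
  have G0D p q : G0 p -> G0 q -> G0 (p + q).
    move=> [c ->] [d ->]; exists (fun i => c i + d i).
    by congr pair => /=; rewrite -big_split; apply: eq_bigr => i _; rewrite scalerDl.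
  have G0Z (x : R) p : G0 p -> G0 (x *: p).
    move=> [c ->]; exists (fun i => x * c i).
    by congr pair => /=; rewrite scaler_sumr; apply: eq_bigr => i _; rewrite scalerA.
  have [y [c [/esym cg ->]]|h hE] :=
    functional_total (injective_baer injE) (G := Submodule G00 G0D G0Z).
    (* Injectivity of [g] turns a relation among the [g (a i)] into one among the [a i], hence one
       that [e] satisfies. *)
    have /tgen [d cE] : K0 c.
      apply: inj_g; rewrite linear0 linear_sum -[RHS]cg.
      by apply: eq_bigr => i _; rewrite linearZ.
    transitivity (\sum_i \sum_(j < m) d j *: (r j i *: e i)).
      apply: eq_bigr => i _; rewrite cE fct_sumE scaler_suml.
      by apply: eq_bigr => j _; rewrite scalerA.
    rewrite exchange_big big1 //= => j _; rewrite -scaler_sumr.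
    by rewrite -[X in _ *: X]/(rho e j) e0 scaler0.
  have hg i : h (g (a i)) = e i.
    apply: hE; exists (fun j => (j == i)%:R).
    have sum1 (X : lmodType R) (v : 'I_n -> X) : v i = \sum_j (j == i)%:R *: v j.
      rewrite (bigD1 i) //= eqxx scale1r big1 ?addr0 // => j /negPf ->.
      by rewrite scale0r.
    by congr pair; exact: sum1.
  (* Evaluating the vanishing tensor at [(phi, b) |-> phi (h b)] yields [Phi e = 0]. *)
  have := tensor_zero_eval (balanced_charfun h) s0.
  rewrite /tensor_eval sE !big_map /= => <-.
  by apply: eq_bigr => i _; rewrite hg.
have [Psi PsiD PsiE] := char_factor PhiD Phi0.
pose psi := char_coord PsiD.
have phiE i : phi i = \sum_j (r j i : R^c) *: psi j.
  apply: charmod_ext => x; rewrite char_sum.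
  (* Comparing [Phi] with [Psi] after [rho] on tuples supported at [i] isolates [phi i]. *)
  transitivity (Phi (single i x)).
    rewrite /Phi (bigD1 i) //= {1}/single eqxx big1 ?addr0 // => k /negPf ki.
    by rewrite /single ki zadditive0 //; exact: charfunD.
  rewrite -PsiE (char_coordE PsiD); apply: eq_bigr => j _.
  rewrite -[RHS]/(charfun (psi j) (r j i *: x)); congr (charfun _ _).
  rewrite /= /rho (bigD1 i) //= {1}/single eqxx big1 ?addr0 // => k /negPf ki.
  by rewrite /single ki scaler0.
apply/tcls_eq0; rewrite tcls_sum sE big_map /=.
transitivity (\sum_i \sum_j tens (psi j) (r j i *: a i)).
  by apply: eq_bigr => i _; rewrite phiE tens_suml; apply: eq_bigr => j _; rewrite tensZ.
rewrite exchange_big big1 //= => j _.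
by rewrite -tens_sumr ra tens0r.
Qed.

Lemma flat_char_baer (R : pzRingType) (E : lmodType R) :
  (forall I : submodule R^o, fingen I) -> flat_mod (charmod E) -> baer E.
Proof.
move=> fg flE I g gD gZ; have [s sI sgen] := fg I.
pose n := size s.
have sI' (i : 'I_n) : I s`_i by apply: sI; rewrite mem_nth.
pose a (i : 'I_n) : submod_type I := submod_elt (sI' i).
pose gI := mk_linear (ideal_map_linear gD gZ).
apply: contrapT => nex.
(* [g] is multiplication by an element exactly when its values on the generators form a tuple in
   [H]. *)
pose H (e : 'I_n -> E) := exists x : E, e = fun i : 'I_n => (s`_i : R) *: x.
have [||||chi chiD [chi0 chig]] := @char_separate _ H (fun i => gI (a i)).
- by exists 0; apply/funext => i; rewrite scaler0.
- by move=> _ _ [x ->] [y ->]; exists (x + y); apply/funext => i; rewrite scalerDr.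
- by move=> _ [x ->]; exists (- x); apply/funext => i; rewrite scalerN.
- move=> [x xE]; apply: nex; exists x => y Iy.
  have [c yE] := sgen _ Iy.
  have yE' : submod_elt Iy = \sum_(i < n) c i *: a i.
    apply: submod_inc_inj; rewrite linear_sum /= [LHS]yE.
    by apply: eq_bigr.
  rewrite -[LHS]/(gI (submod_elt Iy)) yE' linear_sum yE scaler_suml.
  apply: eq_bigr => i _; transitivity (c i *: ((s`_i : R) *: x)); last by rewrite scalerA.
  by rewrite linearZ; congr (_ *: _); exact: (congr1 (@^~ i) xE).
pose phi := char_coord chiD.
pose w := [seq (phi i, a i) | i <- index_enum 'I_n].
have w0 : tensor_zero w.
  apply: (flE _ _ (submod_inc I)); first exact: submod_inc_inj.
  apply/tcls_eq0; rewrite tcls_sum !big_map /=.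
  (* Over [R] each generator moves across the tensor, leaving the character [x |-> chi (s_i x)_i],
     which is zero because [chi] kills [H]. *)
  transitivity (\sum_(i < n) tens ((s`_i : R^c) *: phi i) (1 : R^o)).
    apply: eq_bigr => i _; rewrite tensZ; congr tens.
    by rewrite /GRing.scale /= mulr1.
  rewrite -tens_suml (_ : \sum_(i < n) _ = 0) ?tens0l //.
  apply: charmod_ext => x; rewrite char_sum.
  rewrite -[RHS](chi0 (fun i : 'I_n => (s`_i : R) *: x)); last by exists x.
  by rewrite (char_coordE chiD).
apply: chig; rewrite (char_coordE chiD).
by have := tensor_zero_eval (balanced_charfun gI) w0; rewrite /tensor_eval big_map.
Qed.

(** * Direct sums of injectives *)

Section LeftCharacterModule.
Variables (R : pzRingType) (L : lmodType R^c).

(* [charmod L] is a module over [R^c^c], which has the operations of [R] but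
   is not convertible to it as a structure. *)
Definition left_charmod := charmod L.
HB.instance Definition _ := GRing.Zmodule.on left_charmod.
HB.instance Definition _ :=
  GRing.Zmodule_isLmodule.Build R left_charmod
    (@scalerA R^c^c (charmod L)) (@scale1r R^c^c (charmod L))
    (@scalerDr R^c^c (charmod L)) (fun v a b => @scalerDl R^c^c (charmod L) v a b).

End LeftCharacterModule.

Section FiniteSupport.
Variable R : pzRingType.

(** [Hom_Z(R, Q/Z)], where [R] is a right module over itself so that the dual is a left module. *)
Definition coreg : lmodType R := left_charmod (R^c^o).

Lemma coreg_scale (r : R) (phi : coreg) (x : R) : charfun (r *: phi) x = charfun phi (x * r).
Proof. by []. Qed.

(** Evaluation at 1 identifies linear maps into [coreg] with characters, which extend;
    [b |-> (y |-> psi (y b))] recovers the linear map. *)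
Lemma coreg_injective : injective_mod coreg.
Proof.
move=> A B i inj_i g.
have phiD : zadditive (fun a => charfun (g a) (1 : R)) by move=> a b; rewrite linearD.
have [a|psi psiD psiE] := @char_factor _ _ i _ phiD.
  by rewrite -(linear0 i) => /inj_i ->; rewrite linear0.
have hD b : zadditive (fun y : R^c^o => psi ((y : R) *: b)).
  by move=> x y; rewrite scalerDl psiD.
pose h b : coreg := exist _ _ (hD b).
have lin_h : linear h.
  move=> r b c; apply: charmod_ext => x.
  rewrite -[LHS]/(psi ((x : R) *: (r *: b + c))) scalerDr psiD scalerA.
  by [].
exists (mk_linear lin_h) => a; apply: charmod_ext => x /=.
by rewrite -linearZ psiE linearZ /= [LHS]coreg_scale mul1r.
Qed.

Lemma prod_injective (T : Type) (E : lmodType R) :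
  injective_mod E -> injective_mod (T -> E).
Proof.
move=> injE A B i inj_i g.
have lin_g t : linear (fun a => g a t) by move=> r a b; rewrite linearP.
have ext t := cid (injE _ _ i inj_i (mk_linear (lin_g t))).
pose h b t := proj1_sig (ext t) b.
have lin_h : linear h by move=> r a b; apply/funext => t; rewrite /h linearP.
exists (mk_linear lin_h) => a; apply/funext => t /=.
by rewrite /h; case: (ext t).
Qed.

Section Sequences.
Variable E : lmodType R.

Definition eventually0 (u : nat -> E) := exists N, forall n, (N <= n)%N -> u n = 0.

Fact eventually0_0 : eventually0 0.
Proof. by exists 0%N. Qed.
Fact eventually0D u v : eventually0 u -> eventually0 v -> eventually0 (u + v).
Proof.
move=> [N u0] [N' v0]; exists (maxn N N') => n; rewrite geq_max => /andP [Nn Nn'].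
by rewrite fctE u0 // v0 // addr0.
Qed.
Fact eventually0Z (r : R) u : eventually0 u -> eventually0 (r *: u).
Proof. by move=> [N u0]; exists N => n Nn; rewrite fctE u0 // scaler0. Qed.

Definition fsupp := Submodule eventually0_0 eventually0D eventually0Z.

Definition truncate N (u : nat -> E) : nat -> E := fun n => if (n < N)%N then u n else 0.

Lemma truncate_fsupp N u : fsupp (truncate N u).
Proof. by exists N => n; rewrite leqNgt /truncate => /negPf ->. Qed.

Lemma truncate_linear N : linear (fun u => submod_elt (truncate_fsupp N u)).
Proof.
move=> r u v; apply: val_inj; apply/funext => n /=.
rewrite -[RHS]/(r *: truncate N u n + truncate N v n) /truncate.
by case: ifP => _ //; rewrite scaler0 addr0.
Qed.

(* Finitely many elements of the direct sum are fixed by one truncation, so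
   the direct sum is a pure submodule of the product. *)
Lemma fsupp_pure (M : lmodType R^c) (s : seq (M * submod_type fsupp)) :
  tensor_zero [seq (p.1, submod_inc fsupp p.2) | p <- s] -> tensor_zero s.
Proof.
have [N Ns] : exists N, forall p, p \in s ->
    submod_elt (truncate_fsupp N (submod_val p.2)) = p.2.
  suff [N Ns] : exists N, forall p, p \in s ->
      forall n, (N <= n)%N -> submod_val p.2 n = 0.
    exists N => p sp; apply: val_inj; apply/funext => n /=; rewrite /truncate.
    by case: ltnP => // /(Ns _ sp).
  elim: s => [|p s [N Ns]]; first by exists 0%N.
  have [N' pN'] := submod_valP p.2.
  exists (maxn N N') => q; rewrite inE => qs n; rewrite geq_max => /andP [Nn Nn'].
  by case/orP: qs => [/eqP ->|/Ns ->] //; exact: pN'.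
move=> /(tequiv_map idfun (mk_linear (truncate_linear N))).
rewrite /tensor_map -map_comp /=; congr tequiv.
rewrite -[RHS]map_id; apply/eq_in_map => -[m u] /Ns /= uE.
by congr pair.
Qed.

(** Purity extends the evaluation pairing of the direct sum and its dual to the whole product, which
    gives a section of the dual of the inclusion. *)
Lemma fsupp_char_flat :
  flat_mod (charmod (nat -> E)) -> flat_mod (charmod (submod_type fsupp)).
Proof.
have [b bb bE] := balanced_extend (@fsupp_pure (charmod (submod_type fsupp)))
  (balanced_charfun idfun).
have [i iE] := balanced_linear bb.
apply: (flat_mod_retract (i := i) (p := mk_linear (dualmap_linear (submod_inc fsupp)))).
by move=> phi; apply: charmod_ext => u; rewrite /= iE bE.
Qed.

End Sequences.

Lemma fsupp_coreg_noetherian :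
  injective_mod (submod_type (fsupp coreg)) -> left_noetherian R.
Proof.
move=> injS I idI I_S.
have I_le n m x : (n <= m)%N -> I n x -> I m x.
  by move/subnKC <-; elim: (m - n)%N => [|k IH]; rewrite ?addn0 // addnS => /IH; exact: I_S.
pose U0 (x : R^o) := exists n, I n x.
have U00 : U0 0 by exists 0%N; case: (idI 0%N).
have U0D x y : U0 x -> U0 y -> U0 (x + y).
  move=> [n nx] [m my]; exists (maxn n m); case: (idI (maxn n m)) => _ addI _.
  by apply: addI; [exact: I_le (leq_maxl _ _) nx | exact: I_le (leq_maxr _ _) my].
have U0Z (r : R) x : U0 x -> U0 (r *: x).
  by move=> [n nx]; exists n; case: (idI n) => _ _; exact.
pose U := Submodule U00 U0D U0Z.
have ex n : exists q : coreg, (forall x, I n x -> charfun q x = 0) /\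
    ((forall x, U x -> charfun q x = 0) -> forall x, U x -> I n x).
  have [UI|] := pselect (forall x, U x -> I n x); first by exists 0.
  move=> /existsNP [x /not_implyP [Ux nIx]].
  have [I0 ID IZ] := idI n.
  have [|||//|chi chiD [chi0 chix]] := @char_separate R^c^o (I n) x => //.
    by move=> y /(IZ (-1)); rewrite mulN1r.
  exists (exist _ chi chiD); split=> // /(_ x Ux).
  by move/chix.
pose q n := proj1_sig (cid (ex n)).
have q0 n x : I n x -> charfun (q n) x = 0.
  by rewrite /q; case: cid => ? /= [+ _]; exact.
have qU n : (forall x, U x -> charfun (q n) x = 0) -> forall x, U x -> I n x.
  by rewrite /q; case: cid => ? /= [_].
(* Once [x] lies in [I n], so does [y x], and [(x q_n)(y) = q_n (y x) = 0]. *)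
have sq (x : submod_type U) : fsupp coreg (fun n => (submod_val x : R) *: q n).
  have [N Nx] := submod_valP x; exists N => n Nn.
  apply: charmod_ext => y; rewrite coreg_scale q0 //.
  by have [_ _] := idI n; apply; exact: I_le Nn Nx.
have lin_g : linear (fun x => submod_elt (sq x)).
  move=> r x y; apply: val_inj; apply/funext => n /=.
  rewrite -[LHS]/((r * submod_val x + submod_val y) *: q n) scalerDl -scalerA.
  by [].
have [h hE] := injS _ _ (submod_inc U) (@submod_inc_inj _ _ U) (mk_linear lin_g).
(* The finite support of [h 1] provides the bound: [y q_N = y (h 1)_N = 0] for [y] in [U], so [q_N]
   kills [U]. *)
have [N uN] := submod_valP (h 1).
exists N => n _ x nx; apply: (qU N); last by exists n.
move=> y Uy.
have yq : (y : R) *: q N = 0.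
  have hy : h y = (y : R) *: h 1.
    by rewrite -linearZ; congr (h _); rewrite /GRing.scale /= mulr1.
  have := hE (submod_elt Uy); rewrite /= hy => /(congr1 (fun u => submod_val u N)) /= <-.
  by rewrite -[LHS]/((y : R) *: submod_val (h 1) N) uN // scaler0.
by rewrite -[y]mul1r -coreg_scale yq.
Qed.

End FiniteSupport.

(** * Preenvelopes against precovers of duals, and envelopes from flat covers *)

Theorem theorem3p7 (R : pzRingType) :
  (left_noetherian R <->
   (forall (A E : lmodType R) (f : {linear A -> E}), injective f ->
      (inj_preenvelope f <-> flat_precover (dualmap f))))
  /\
  (left_noetherian R ->
   forall (A E : lmodType R) (f : {linear A -> E}), injective f ->
     flat_cover (dualmap f) -> inj_envelope f).
Proof.
have noeth2 : left_noetherian R ->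
   forall (A E : lmodType R) (f : {linear A -> E}), injective f ->
      (inj_preenvelope f <-> flat_precover (dualmap f)).
  move=> noethR A E f inj_f; split=> [[injE _]|[flE _]].
    split; first exact: injective_char_flat.
    by move=> G g; exact: flat_lift.
  split; first exact/baer_injective/flat_char_baer/flE/noetherian_fingen.
  by move=> E' g injE'; exact: injE' inj_f g.
split; first split=> // pre; last first.
  move=> noethR A E f inj_f [flf minf]; split; first exact/noeth2.
  (* Dualizing [h f = f] gives [f^+ h^+ = f^+], so right minimality applies to [h^+]. *)
  move=> h hf; apply: dual_bij; apply: (minf (mk_linear (dualmap_linear h))) => phi.
  by apply: charmod_ext => a /=; rewrite hf.
(* For the identity of [E], being a preenvelope means that [E] is injective, and its dual being a
   precover means that [E^+] is flat. *)
have inj_flat (E : lmodType R) : injective_mod E -> flat_mod (charmod E).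
  move=> injE; have [|//] := (pre E E idfun (@inj_id _)).1.
  by split=> // E' g _; exists g.
have flat_inj (E : lmodType R) : flat_mod (charmod E) -> injective_mod E.
  move=> flE; have [|//] := (pre E E idfun (@inj_id _)).2.
  split=> // G g _; exists g => x; exact: charmod_ext.
apply: fsupp_coreg_noetherian; apply: flat_inj; apply: fsupp_char_flat.
exact/inj_flat/prod_injective/coreg_injective.
Qed.
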